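(* Let $\alpha\in(0,1)$, $E>0$, $\eta>0$. Assume that $\sigma:\mathbb{R}_{+}\to\mathbb{R}_{+}$ is a continuous, convex and decreasing function. Let $$\mathbf{E}_{0}:=\lim_{\epsilon\to 0}\frac{\sigma(\epsilon)}{\epsilon},\qquad \mathbf{E}_{\infty}:=\lim_{\epsilon\to\infty}\frac{\sigma(\epsilon)}{\epsilon}.$$ If $\mathbf{E}_{0}=\infty$ and $\mathbf{E}_{\infty}=0$, then the problem $$\eta^{\alpha}\left({}^{C}D_{0}^{\alpha}\epsilon\right)(t)+E^{\alpha}\epsilon(t)=\sigma(\epsilon(t)),\quad 0<t\leq 1,\qquad \epsilon(0)=0,$$ has at least one nontrivial positive bounded solution $\epsilon\in X$.
   Context: $\mathbb{R}_{+}=[0,\infty)$, and the limit $\epsilon\to 0$ is taken through positive values. $X=C[0,1]$ is the Banach space of continuous real functions on $[0,1]$ with the supremum norm. ${}^{C}D_{0}^{\alpha}$ denotes the Caputo fractional derivative of order $\alpha\in(0,1)$ with base point $0$: $\left({}^{C}D_{0}^{\alpha}\epsilon\right)(t)=\frac{1}{\Gamma(1-\alpha)}\frac{d}{dt}\int_0^t (t-s)^{-\alpha}\left(\epsilon(s)-\epsilon(0)\right)ds$ (which equals $\frac{1}{\Gamma(1-\alpha)}\int_0^t (t-s)^{-\alpha}\epsilon'(s)\,ds$ when $\epsilon$ is absolutely continuous). A positive solution means a solution lying in the cone $K=\{\epsilon\in X:\ \epsilon(t)\ge 0,\ 0\le t\le 1\}$; nontrivial means not identically zero. *)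

(* Defs.v *)
From HB Require Import structures.
From mathcomp Require Import all_boot all_order all_algebra.
From mathcomp Require Import all_classical all_reals all_analysis.

Set Implicit Arguments.
Unset Strict Implicit.
Unset Printing Implicit Defensive.

Import Order.TTheory GRing.Theory Num.Theory.
Import numFieldNormedType.Exports.

Local Open Scope classical_set_scope.
Local Open Scope ring_scope.

Definition Gamma (R : realType) (z : R) : R :=
  \int[lebesgue_measure]_(x in `]0, +oo[) (x `^ (z - 1) * expR (- x)).

(* Derivative at t relative to D: two-sided at interior points of D, one-sided
   at an endpoint of an interval D. *)
Definition is_derive_within (R : realType) (D : set R) (g : R -> R) (t l : R) :
    Prop :=
  (g s - g t) / (s - t) @[s --> within D t^'] --> l.

(* At s = t the kernel (t - s) `^ (- a) takes the junk value 0 when a != 0;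
   this is a null set for the integral. *)
Definition caputo_integral (R : realType) (a : R) (u : R -> R) (t : R) : R :=
  \int[lebesgue_measure]_(s in `[0, t]) ((t - s) `^ (- a) * (u s - u 0)).

(* "The Caputo derivative of order a with base point 0 of u exists at t and
   equals d", for u a function on [0, 1]; only the values of u on [0, 1] matter
   when t is in [0, 1]. *)
Definition is_caputo (R : realType) (a : R) (u : R -> R) (t d : R) : Prop :=
  exists2 l, is_derive_within `[0, 1] (caputo_integral a u) t l
           & d = (Gamma (1 - a))^-1 * l.

(* Elements of C[0,1] are represented by functions on R, of which only the
   restriction to [0, 1] is relevant. *)
Definition C01 (R : realType) : set (R -> R) :=
  [set u : R -> R | {within `[0, 1], continuous u}].

Definition K01 (R : realType) : set (R -> R) :=
  [set u : R -> R | C01 u /\ forall t : R, 0 <= t <= 1 -> 0 <= u t].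

(* Main.v *)
Require Import Defs.
From HB Require Import structures.
From mathcomp Require Import all_boot all_order all_algebra.
From mathcomp Require Import all_classical all_reals all_analysis.
From mathcomp Require Import measurable_realfun.
From mathcomp Require Import ring lra.

Set Implicit Arguments.
Unset Strict Implicit.
Unset Printing Implicit Defensive.

Import Order.TTheory GRing.Theory Num.Theory.
Import numFieldNormedType.Exports.

Local Open Scope classical_set_scope.
Local Open Scope ring_scope.

(** Write [f x := sigma x - E `^ alpha * x]. The problem reads
    [eta `^ alpha * D eps = f \o eps], [eps 0 = 0], with [D] the Caputo derivative,
    and it is solved through the equivalent Volterra equation
      eps t = c * int_0^t (t - s)^(alpha - 1) f (eps s) ds
    whose right-hand side is [c * rlint alpha (f \o eps) t].

    Since [sigma x / x] is unbounded near [0] and [sigma] decreases, [sigma 0 > 0];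
    hence [f 0 > 0], and [f], which decreases strictly to [-oo], has a zero [xs]
    on the positive half-line. Let [phi] be [f] precomposed with the projection onto
    [[0, xs]]: it is uniformly continuous, with values in [[0, sigma 0]].

    Existence ([volterra_exists]). The function [f] may fail to be Lipschitz at [0],
    which is where the solution starts, so compactness is used instead of
    contraction. Delaying the argument of [phi] by [d > 0] gives an equation
    that is solved by finitely many iterations. All these delayed solutions are bounded
    and Hoelder of exponent [alpha] with the same constants ([rlint_holder], from
    the estimate [integral_powker_diff] on translates of the kernel), so they
    cluster uniformly on [[0, 1]] as [d] tends to [0] ([holder_cluster]), and a
    cluster point [u] solves the Volterra equation for [phi].

    Invariance of [[0, xs]] ([rlint_le_threshold]). As [phi >= 0], also [u >= 0].
    Above the level [xs] the source [phi \o u] vanishes, and without source the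
    integral can only decrease with [t], because the kernel does; so [u] never exceeds
    [xs], and [phi (u t) = f (u t)].

    Back to the Caputo derivative ([caputo_integral_rlint]). The convolution of
    [x^(- alpha)] and [x^(alpha - 1)] on the positive half-line is constant, equal to
    [B = betacst alpha]. By Tonelli's theorem the Caputo integral of [u] is therefore
    [B * c * int_0^t phi (u s) ds], and the fundamental theorem of calculus
    differentiates it. The choice [c = Gamma (1 - alpha) / (eta `^ alpha * B)] gives
    the equation. Finally [u] is not zero, since for [u = 0] the Caputo integral would
    be zero whereas [phi 0 = sigma 0 > 0]. *)

(** * Affine changes of variable for the Lebesgue measure *)

Section affine.
Context {R : realType}.
Notation mu := (@lebesgue_measure R).
Local Open Scope ereal_scope.

Let aff (a b : R) : measurableTypeR R -> measurableTypeR R := fun x => (a * x + b)%R.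

Let maff a b : measurable_fun setT (aff a b).
Proof. by apply: measurable_funD => //; apply: measurable_funM. Qed.

(** Both sides are measures in [A], and they agree on half-open intervals. *)
Lemma lebesgue_measure_affine (a b : R) (A : set R) : (0 < a)%R -> measurable A ->
  mu A = a%:E * pushforward mu (aff a b) A.
Proof.
move=> a0 mA.
pose k : {nonneg R} := NngNum (ltW a0).
have := @lebesgue_measure_unique R (mscale k
  (measure_function_pushforward__canonical__measure_function_Measure mu (maff a b))) _ _ mA.
apply => _ [[x y]] _ <-.
rewrite /mscale /pushforward.
have E : aff a b @^-1` `]x, y] = `](((x - b) / a)%R), (((y - b) / a)%R)]%classic :> set R.
  apply/seteqP; split => z /=; rewrite /aff !in_itv/= => /andP[h1 h2]; apply/andP; split.
  - by rewrite ltr_pdivrMr//; lra.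
  - by rewrite ler_pdivlMr//; lra.
  - by move: h1; rewrite ltr_pdivrMr//; lra.
  - by move: h2; rewrite ler_pdivlMr//; lra.
transitivity (a%:E * mu `](((x - b) / a)%R), (((y - b) / a)%R)]); last by rewrite -E.
rewrite !lebesgue_measure_itv/= !lte_fin ltr_pM2r ?invr_gt0// ltrBlDr subrK.
case: ifPn => _; last by rewrite mule0.
by rewrite -!EFinB -EFinM; congr EFin; field; rewrite gt_eqF.
Qed.

Lemma ge0_integral_affine (a b : R) (f : R -> \bar R) : (0 < a)%R ->
  measurable_fun setT f -> (forall x, 0 <= f x) ->
  \int[mu]_x f x = a%:E * \int[mu]_x f (a * x + b)%R.
Proof.
move=> a0 mf f0.
pose k : {nonneg R} := NngNum (ltW a0).
pose nu : {measure set (measurableTypeR R) -> \bar R} :=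
  measure_function_pushforward__canonical__measure_function_Measure mu (maff a b).
transitivity (\int[mscale k nu]_x f x).
  by apply: eq_measure_integral => A mA _; exact: lebesgue_measure_affine.
rewrite ge0_integral_mscale//; congr (_ * _).
by rewrite (ge0_integral_pushforward (maff a b)).
Qed.

Lemma ge0_integral_reflect (t : R) (f : R -> \bar R) :
  measurable_fun setT f -> (forall x, 0 <= f x) ->
  \int[mu]_x f (t - x)%R = \int[mu]_x f x.
Proof.
move=> mf f0.
pose N : measurableTypeR R -> measurableTypeR R := -%R.
have mN : measurable_fun setT N by exact: oppr_measurable.
pose nu : {measure set (measurableTypeR R) -> \bar R} :=
  measure_function_pushforward__canonical__measure_function_Measure mu mN.
have -> : \int[mu]_x f x = \int[mu]_x f (- x)%R.
  transitivity (\int[nu]_x f x).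
    by apply: eq_measure_integral => A mA _; exact/esym/lebesgue_measureN.
  by rewrite (ge0_integral_pushforward mN).
rewrite [RHS](@ge0_integral_affine 1 (- t))//; last first.
  by apply: measurableT_comp mf _; exact: oppr_measurable.
by rewrite mul1e; apply: eq_integral => x _; congr f; ring.
Qed.

End affine.

(** * The truncated power kernel *)

Section powker.
Context {R : realType}.
Notation mu := (@lebesgue_measure R).
Implicit Types p x a t : R.

(** Extending [x `^ p] by zero to [x <= 0] turns integrals of [(t - s) `^ p]
    over the moving interval [[0, t]] into integrals of [powker p (t - s)] over a
    fixed one, and [powker p] is homogeneous on the whole line. *)
Definition powker p x : R := if 0 < x then x `^ p else 0.

Lemma powker_ge0 p x : 0 <= powker p x.
Proof. by rewrite /powker; case: ifP => // _; exact: powR_ge0. Qed.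

Lemma powker_gt0 p x : 0 < x -> powker p x = x `^ p.
Proof. by rewrite /powker => ->. Qed.

Lemma powker_le0 p x : x <= 0 -> powker p x = 0.
Proof. by rewrite /powker leNgt; case: ifP. Qed.

Lemma powkerM p a x : 0 < a -> powker p (a * x) = a `^ p * powker p x.
Proof.
move=> a0; rewrite /powker pmulr_rgt0//.
by case: ifPn => [x0|_]; rewrite ?mulr0// powRM// ltW.
Qed.

Lemma powker_anti p x y : p <= 0 -> 0 < x -> x <= y -> powker p y <= powker p x.
Proof.
move=> p0 x0 xy; rewrite !powker_gt0//; last exact: lt_le_trans xy.
rewrite -(opprK p) !(powRN _ (- p)) lef_pV2 ?posrE ?powR_gt0//; last exact: lt_le_trans xy.
by rewrite ge0_ler_powR// ?oppr_ge0// nnegrE ltW//; exact: lt_le_trans xy.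
Qed.

Lemma measurable_powker p : measurable_fun setT (powker p).
Proof.
apply: measurable_fun_ifT => //.
exact: measurable_fun_ltr.
Qed.

Lemma measurable_EFin_powker p (D : set R) : measurable_fun D (fun x => (powker p x)%:E).
Proof.
by apply/measurable_EFinP; apply: measurable_funTS; exact: measurable_powker.
Qed.

Definition powint p : \bar R := (\int[mu]_(x in `[0%R, 1%R]) (powker p x)%:E)%E.

Lemma powint_ge0 p : (0 <= powint p)%E.
Proof. by apply: integral_ge0 => x _; rewrite lee_fin powker_ge0. Qed.

(** Homogeneity of the kernel under the substitution [x := a * x]. *)
Lemma integral_powker p a : -1 < p -> 0 <= a ->
  (\int[mu]_(x in `[0%R, a]) (powker p x)%:E = (a `^ (p + 1))%:E * powint p)%E.
Proof.
move=> p1; rewrite le_eqVlt => /predU1P[<-|a0].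
  by rewrite set_itv1 integral_set1 powR0 ?mul0e// gt_eqF// -ltrBlDr sub0r.
rewrite integral_mkcond (@ge0_integral_affine _ a 0)//; first last.
- by move=> x; rewrite patchE; case: ifPn => // _; rewrite lee_fin powker_ge0.
- apply/(measurable_restrictT _ _).1 => //.
  exact: measurable_EFin_powker.
rewrite powRD ?(gt_eqF a0) ?implybT// powRr1 ?(ltW a0)// mulrC EFinM -muleA; congr (_ * _)%E.
rewrite /powint -ge0_integralZl//; first last.
- by rewrite lee_fin powR_ge0.
- by move=> x _; rewrite lee_fin powker_ge0.
- exact: measurable_EFin_powker.
rewrite [RHS]integral_mkcond; apply: eq_integral => x _.
rewrite addr0 !patchE.
have -> : (a * x \in `[0, a]%classic) = (x \in `[0, 1]%classic).
  by rewrite !mem_setE !in_itv/= pmulr_rge0// ger_pMr.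
by case: ifPn => // _; rewrite powkerM.
Qed.

(** The antiderivative [x `^ (p + 1) / (p + 1)] bounds the integral over
    [[1 / n, 1]] uniformly in [n]; monotone convergence reaches the singularity. *)
Lemma powint_le p : -1 < p -> (powint p <= (p + 1)^-1%:E)%E.
Proof.
move=> p1.
have q0 : 0 < p + 1 by lra.
rewrite /powint -integral_itv_obnd_cbnd; last exact: measurable_EFin_powker.
pose F n : set R := `[n.+2%:R^-1, 1]%classic.
have -> : `]0, 1]%classic = \bigcup_n F n :> set R.
  apply/seteqP; split => x /=.
    rewrite in_itv/= => /andP[x0 x1].
    exists (Num.truncn x^-1) => //; rewrite /F /= in_itv/= x1 andbT.
    rewrite invf_ple ?posrE//.
    have xv : 0 <= x^-1 by rewrite invr_ge0 ltW.
    have /andP[_ /ltW/le_trans] := truncn_itv xv; apply.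
    by rewrite ler_nat.
  move=> [n _]; rewrite /F /= !in_itv/= => /andP[+ ->]; rewrite andbT.
  by move=> h; apply: lt_le_trans h; rewrite invr_gt0.
have cvgF : (\int[mu]_(x in F n) (powker p x)%:E @[n --> \oo] -->
    \int[mu]_(x in \bigcup_n F n) (powker p x)%:E)%E.
  apply: ge0_nondecreasing_set_cvg_integral => //.
  - move=> m n mn; rewrite subsetEset; apply: subset_itvr.
    by rewrite bnd_simp lef_pV2 ?posrE// ler_nat !ltnS.
  - by move=> n; exact: measurable_itv.
  - by move=> n; exact: (@measurable_EFin_powker p (F n)).
  - by move=> n x _; rewrite lee_fin powker_ge0.
rewrite -(cvg_lim _ cvgF)//.
apply: lime_le; first by apply/cvg_ex; eexists; exact: cvgF.
apply: nearW => n.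
have e0 : 0 < n.+2%:R^-1 :> R by rewrite invr_gt0.
have e1 : n.+2%:R^-1 < 1 :> R by rewrite invf_lt1// ltr1n.
set e := n.+2%:R^-1 in e0 e1 *.
pose G x := (p + 1)^-1 * x `^ (p + 1).
rewrite (_ : \int[mu]_(x in _) _ = \int[mu]_(x in `[e, 1%R]) (x `^ p)%:E)%E; last first.
  apply: eq_integral => x; rewrite inE /F /= in_itv/= => /andP[ex _].
  by rewrite powker_gt0// (lt_le_trans e0).
have dG x : 0 < x -> is_derive x 1 G (x `^ p).
  move=> x0; have := is_derive1_powR (p + 1) x0 => h.
  have -> : x `^ p = (p + 1)^-1 *: ((p + 1) * x `^ (p + 1 - 1)).
    by rewrite addrK /GRing.scale/= mulKf// gt_eqF.
  exact: is_deriveZ.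
have cG x : 0 < x -> {for x, continuous G}.
  move=> /dG h; apply: differentiable_continuous; apply/derivable1_diffP.
  exact: ex_derive.
rewrite (@continuous_FTC2 _ _ G)//.
- rewrite -EFinB lee_fin /G powR1 mulr1.
  by rewrite lerBlDr lerDl mulr_ge0 ?powR_ge0// invr_ge0 ltW.
- apply: continuous_in_subspaceT => x; rewrite inE/= in_itv/= => /andP[ex _].
  have x0 : 0 < x by exact: lt_le_trans ex.
  apply: differentiable_continuous; apply/derivable1_diffP.
  by apply: derivable_powR; rewrite in_itv/= x0.
- split.
  + move=> x; rewrite in_itv/= => /andP[ex _].
    by have := dG x (lt_trans e0 ex) => h; exact: ex_derive.
  + by apply: cvg_at_right_filter; exact: cG.
  + by apply: cvg_at_left_filter; exact: cG.
- move=> x; rewrite in_itv/= => /andP[ex _].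
  by have := dG x (lt_trans e0 ex) => h; rewrite derive1E derive_val.
Qed.

End powker.

Section powker_translates.
Context {R : realType}.
Notation mu := (@lebesgue_measure R).
Implicit Types p a b t : R.
Local Open Scope ereal_scope.

Lemma measurable_powker_sub p t (D : set R) :
  measurable_fun D (fun s : R => powker p (t - s)).
Proof.
apply: measurable_funTS.
have -> : (fun s : R => powker p (t - s)) = powker p \o (fun s : R => t - s)%R by [].
apply: measurableT_comp; first exact: measurable_powker.
by apply: measurable_funB => //; exact: measurable_id.
Qed.

Lemma integral_powker_sub p a t : (-1 < p)%R -> (a <= t)%R ->
  \int[mu]_(s in `[a, t]) (powker p (t - s))%:E = ((t - a) `^ (p + 1))%:E * powint p.
Proof.
move=> p1 at_.
have ta : (0 <= t - a)%R by rewrite subr_ge0.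
transitivity (\int[mu]_(x in `[0%R, (t - a)%R]) (powker p x)%:E); last exact: integral_powker.
rewrite [LHS]integral_mkcond.
rewrite [RHS]integral_mkcond.
rewrite -[RHS](ge0_integral_reflect t).
- apply: eq_integral => s _; rewrite !patchE.
  suff -> : ((t - s)%R \in `[0%R, (t - a)%R]%classic) = (s \in `[a, t]%classic) by [].
  by rewrite !mem_setE !in_itv/= subr_ge0 lerD2l lerN2 andbC.
- by apply/(measurable_restrictT _ (measurable_itv _)); exact: measurable_EFin_powker.
- by apply: erestrict_ge0 => x _; rewrite lee_fin powker_ge0.
Qed.

Lemma integral_powker_cut p t b : (-1 < p)%R -> (0 <= t <= b)%R ->
  \int[mu]_(s in `[0%R, b]) (powker p (t - s))%:E = (t `^ (p + 1))%:E * powint p.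
Proof.
move=> p1 /andP[t0 tb].
rewrite -{2}(subr0 t) -integral_powker_sub// [RHS]integral_mkcond [LHS]integral_mkcond.
apply: eq_integral => s _; rewrite !patchE !mem_setE !in_itv/=.
have [s0|//] := leP 0%R s.
have [st|ts] := leP s t; first by rewrite (le_trans st tb).
by rewrite powker_le0 ?if_same// subr_le0 ltW.
Qed.

(** For [s < t] the absolute difference is [powker p (t - s) - powker p (t' - s)],
    because the kernel decreases, and for [t <= s] it is [powker p (t' - s)].
    Integrating, one gets [P t - P t' + 2 * P (t' - t)] for the increasing function
    [P x := x `^ (p + 1) * powint p], hence at most [2 * P (t' - t)]. This is the
    equicontinuity estimate for Abel kernels. *)
Lemma integral_powker_diff p t t' b : (-1 < p <= 0)%R -> (0 <= t <= t')%R -> (t' <= b)%R ->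
  \int[mu]_(s in `[0%R, b]) `|powker p (t' - s) - powker p (t - s)|%:E <=
  (2 * (t' - t) `^ (p + 1))%:E * powint p.
Proof.
move=> /andP[p1 p0] /andP[t0 tt'] t'b.
have t'0 : (0 <= t')%R by exact: le_trans tt'.
set N := integral _ _ _.
pose w s := if (s < t)%R then powker p (t' - s) else 0%R.
have w0 s : (0 <= w s)%R by rewrite /w; case: ifP => // _; exact: powker_ge0.
have mw (D : set R) : measurable_fun D w.
  apply: measurable_funTS; apply: measurable_fun_ifT => //.
    exact: measurable_fun_ltr.
  exact: measurable_powker_sub.
have mk u (D : set R) : measurable_fun D (fun s => (powker p (u - s))%:E).
  by apply/measurable_EFinP; exact: measurable_powker_sub.
have mEw (D : set R) : measurable_fun D (EFin \o w) by exact/measurable_EFinP.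
pose W := \int[mu]_(s in `[0%R, b]) (w s)%:E.
have eN : N + (W + W) = (t `^ (p + 1))%:E * powint p + (t' `^ (p + 1))%:E * powint p.
  rewrite -(@integral_powker_cut p t b)// ?t0 ?(le_trans tt')//.
  rewrite -(@integral_powker_cut p t' b)// ?t'0//.
  have mWW : measurable_fun `[0%R, b] (fun s => (w s)%:E + (w s)%:E).
    exact: emeasurable_funD.
  have mN : measurable_fun `[0%R, b]
      (fun s => `|powker p (t' - s) - powker p (t - s)|%:E).
    apply/measurable_EFinP; apply: (measurableT_comp (@normr_measurable R _)).
    by apply: measurable_funB; exact: measurable_powker_sub.
  have WW0 s : 0 <= (w s)%:E + (w s)%:E by rewrite -EFinD lee_fin addr_ge0.
  rewrite /N /W -!ge0_integralD//;
    try by [exact: mEw | exact: mk | exact: mWW | move=> s _; rewrite lee_fin ?powker_ge0].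
  apply: eq_integral => s _; rewrite -!EFinD; congr EFin; rewrite /w.
  case: ifPn => [st|]; last first.
    rewrite -leNgt => ts; rewrite (@powker_le0 _ _ (t - s)) ?subr_le0//.
    by rewrite subr0 !addr0 add0r ger0_norm ?powker_ge0.
  rewrite ler0_norm; first by ring.
  by rewrite subr_le0 powker_anti ?subr_gt0// lerD2r.
pose H := ((t' - t) `^ (p + 1))%:E * powint p.
have leW : (t' `^ (p + 1))%:E * powint p <= W + H.
  rewrite -(@integral_powker_cut p t' b) ?t'0//.
  rewrite /H -integral_powker_sub//.
  have -> : \int[mu]_(s in `[t, t']) (powker p (t' - s))%:E =
      \int[mu]_(s in `[0%R, b]) ((fun s => (powker p (t' - s))%:E) \_ `[t, t']) s.
    rewrite -integral_mkcondr; congr (integral _ _ _).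
    apply/seteqP; split => s /=; rewrite !in_itv/=; last by case.
    by move=> /andP[ts st']; rewrite ts st' (le_trans t0 ts) (le_trans st' t'b).
  have mr : measurable_fun `[0%R, b] ((fun s => (powker p (t' - s))%:E) \_ `[t, t']).
    by apply: measurable_funTS; apply/(measurable_restrictT _ (measurable_itv _)); exact: mk.
  have r0 (s : R) : 0 <= ((fun s => (powker p (t' - s))%:E) \_ `[t, t']) s.
    by apply: erestrict_ge0 => x _; rewrite lee_fin powker_ge0.
  rewrite -ge0_integralD//;
    try by [exact: mEw | move=> s _; rewrite lee_fin | move=> s _; exact: r0].
  apply: ge0_le_integral => //.
  - by move=> s _; rewrite lee_fin powker_ge0.
  - exact: mk.
  - by apply: emeasurable_funD; [exact: mEw|exact: mr].
  move=> s _; rewrite patchE /w mem_setE in_itv/=; case: ltP => ts /=.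
    by rewrite adde0.
  rewrite add0e; case: (leP s t') => // st'.
  by rewrite powker_le0// subr_le0 ltW.
have [c cE] : exists c : R, powint p = c%:E.
  have /fineK <- : powint p \is a fin_num; last by eexists.
  rewrite ge0_fin_numE ?powint_ge0//.
  by apply: le_lt_trans (powint_le p1) _; rewrite ltry.
have c0 : (0 <= c)%R by rewrite -lee_fin -cE powint_ge0.
have ltt' : (t `^ (p + 1) <= t' `^ (p + 1))%R.
  by rewrite ge0_ler_powR// ?nnegrE//; lra.
have N0 : 0 <= N by apply: integral_ge0 => s _; rewrite lee_fin.
have W0 : 0 <= W by apply: integral_ge0 => s _; rewrite lee_fin.
(* a linear statement in the finite numbers [N] and [W] *)
clearbody N W; rewrite /H {H} !cE -!EFinM in eN leW *.
move: N W eN leW N0 W0 => [N| |] [W| |]//; rewrite -!EFinD !lee_fin => -[e] h _ _.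
have := ler_wpM2r c0 ltt'.
lra.
Qed.

End powker_translates.

(** * Convolution of two power kernels *)

Section beta.
Context {R : realType}.
Notation mu := (@lebesgue_measure R).
Implicit Types p q r t : R.
Local Open Scope ereal_scope.

(** Euler's Beta function at [(q + 1, p + 1)]: the integrand vanishes outside
    [[0, 1]]. *)
Definition betaint p q : \bar R :=
  \int[mu]_x (powker p (1 - x) * powker q x)%:E.

Let mbeta p q t : measurable_fun [set: R] (fun s => (powker p (t - s) * powker q s)%:E).
Proof.
apply/measurable_EFinP; apply: measurable_funM; first exact: measurable_powker_sub.
exact: measurable_powker.
Qed.

Let mbeta_shift p q r t :
  measurable_fun [set: R] (fun s => (powker p (t - s) * powker q (s - r))%:E).
Proof.
apply/measurable_EFinP; apply: measurable_funM; first exact: measurable_powker_sub.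
apply: (measurableT_comp (measurable_powker q)).
by apply: measurable_funB => //; exact: measurable_id.
Qed.

(** The substitution [s := (t - r) * x + r] carries [[0, 1]] onto [[r, t]]; when
    [p + q + 1 = 0] the result does not depend on [r] and [t]. *)
Lemma integral_powker_conv p q r t : (r < t)%R ->
  \int[mu]_s (powker p (t - s) * powker q (s - r))%:E =
  ((t - r) `^ (p + q + 1))%:E * betaint p q.
Proof.
move=> rt; have d0 : (0 < t - r)%R by rewrite subr_gt0.
have k0 (u v : R) : 0 <= (powker p u * powker q v)%:E.
  by rewrite lee_fin mulr_ge0// powker_ge0.
rewrite (ge0_integral_affine r d0 (@mbeta_shift p q r t) (fun s => k0 _ _)).
have -> : ((t - r) `^ (p + q + 1) = (t - r) * (t - r) `^ (p + q))%R.
  by rewrite powRD ?(gt_eqF d0) ?implybT// powRr1 ?(ltW d0)// mulrC.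
rewrite EFinM -muleA; congr (_ * _).
have pq0 : 0 <= ((t - r) `^ (p + q))%:E by rewrite lee_fin powR_ge0.
rewrite /betaint -ge0_integralZl; [|exact: measurableT|exact: mbeta|by move=> x _; exact: k0|by []].
apply: eq_integral => x _; rewrite addrK -EFinM; congr EFin.
have -> : (t - ((t - r) * x + r) = (t - r) * (1 - x))%R by ring.
by rewrite !powkerM// powRD ?(gt_eqF d0) ?implybT//; ring.
Qed.

Lemma betaint_gt0 p q : (p <= 0)%R -> (q <= 0)%R -> 0 < betaint p q.
Proof.
move=> p0 q0.
have ge1 r (x : R) : (r <= 0)%R -> (0 < x <= 1)%R -> (1 <= powker r x)%R.
  move=> r0 /andP[x0 x1]; have := powker_anti r0 x0 x1.
  by rewrite {1}powker_gt0// powR1.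
apply: (@lt_le_trans _ _ (\int[mu]_(x in `]0%R, 1%R[) (cst 1 x))).
  by rewrite integral_cst//= lebesgue_measure_itv/= lte_fin ltr01 mul1e sube0 lte_fin.
rewrite integral_mkcond; apply: ge0_le_integral => //.
- by move=> x _; rewrite patchE; case: ifP => // _; rewrite lee_fin.
- by apply/(measurable_restrictT _ (measurable_itv _)); exact: measurable_cst.
- exact: mbeta.
- move=> x _; rewrite patchE mem_setE in_itv/=.
  case: ifPn => [/andP[x0 x1]|_]; last by rewrite lee_fin mulr_ge0// powker_ge0.
  rewrite lee_fin -[leLHS]mulr1; apply: ler_pM => //; apply: ge1 => //.
    by rewrite subr_gt0 x1 gerBl ltW.
  by rewrite x0 ltW.
Qed.

(** Each half of [[0, 1]] meets only one of the two singularities; there the other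
    factor is at most its value at [1 / 2]. *)
Lemma betaint_fin_num p q : (-1 < p <= 0)%R -> (-1 < q <= 0)%R ->
  betaint p q \is a fin_num.
Proof.
move=> /andP[p1 p0] /andP[q1 q0].
have half (r : R) : (0 <= 2^-1 `^ r :> R)%R by exact: powR_ge0.
have finp r : (-1 < r)%R -> powint r < +oo.
  by move=> r1; apply: le_lt_trans (powint_le r1) _; rewrite ltry.
rewrite ge0_fin_numE; last by apply: integral_ge0 => x _; rewrite lee_fin mulr_ge0// powker_ge0.
apply: (@le_lt_trans _ _ (\int[mu]_(x in `[0%R, 1%R])
  ((2^-1 `^ p)%:E * (powker q x)%:E + (2^-1 `^ q)%:E * (powker p (1 - x))%:E))); last first.
  have mk2 : measurable_fun (`[0%R, 1%R] : set R) (fun x : R => (powker p (1 - x))%:E).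
    by apply/measurable_EFinP; exact: measurable_powker_sub.
  have mk1 : measurable_fun (`[0%R, 1%R] : set R) (fun x : R => (powker q x)%:E).
    exact: measurable_EFin_powker.
  rewrite ge0_integralD//; first last.
  - exact: measurable_funeM.
  - by move=> x _; rewrite mule_ge0// lee_fin powker_ge0.
  - exact: measurable_funeM.
  - by move=> x _; rewrite mule_ge0// lee_fin powker_ge0.
  rewrite !ge0_integralZl//; first last.
  - by move=> x _; rewrite lee_fin powker_ge0.
  - by move=> x _; rewrite lee_fin powker_ge0.
  rewrite integral_powker_sub// subr0 powR1 mul1e.
  by apply: lte_add_pinfty; apply: lte_mul_pinfty; rewrite ?lee_fin// finp.
rewrite [leRHS]integral_mkcond; apply: ge0_le_integral => //.
- by move=> x _; rewrite lee_fin mulr_ge0// powker_ge0.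
- exact: mbeta.
- apply/(measurable_restrictT _ (measurable_itv _)).
  apply: emeasurable_funD; apply: measurable_funeM.
    exact: measurable_EFin_powker.
  by apply/measurable_EFinP; exact: measurable_powker_sub.
move=> x _; rewrite patchE mem_setE in_itv/=.
have [x0|x0] := leP x 0%R.
  rewrite (@powker_le0 _ q)// mulr0; case: ifP => // _.
  by rewrite adde_ge0// mule_ge0// lee_fin powker_ge0.
have [x1|x1] /= := leP 1%R x.
  rewrite (@powker_le0 _ p (1 - x)) ?subr_le0// mul0r; case: ifP => // _.
  by rewrite adde_ge0// mule_ge0// lee_fin powker_ge0.
rewrite (ltW x0) (ltW x1)/= -!EFinM -EFinD lee_fin.
have h2 : (0 < 2^-1 :> R)%R by rewrite invr_gt0.
have [xh|xh] := leP x 2^-1%R.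
  rewrite -[leLHS]addr0 lerD ?mulr_ge0 ?powker_ge0// ler_wpM2r ?powker_ge0//.
  rewrite -(powker_gt0 _ h2) powker_anti//; lra.
rewrite mulrC -[leLHS]add0r lerD ?mulr_ge0 ?powker_ge0// ler_wpM2r ?powker_ge0//.
by rewrite -(powker_gt0 _ h2) powker_anti// ltW.
Qed.

End beta.

(** * The Riemann-Liouville integral *)

Section riemann_liouville.
Context {R : realType}.
Notation mu := (@lebesgue_measure R).
Implicit Types (a s t M : R) (g h : R -> R).

Lemma Rintegral_mul_bounded (k g : R -> R) (K M : R) :
  measurable_fun (`[0, 1] : set R) k -> measurable_fun (`[0, 1] : set R) g ->
  (\int[mu]_(s in `[0%R, 1%R]) `|k s|%:E <= K%:E)%E ->
  {in `[0, 1], forall s, `|g s| <= M} ->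
  mu.-integrable (`[0, 1] : set R) (EFin \o (fun s => k s * g s)) /\
  `|\int[mu]_(s in `[0, 1]) (k s * g s)| <= K * M.
Proof.
move=> mk mg kK gM.
have M0 : 0 <= M by apply: le_trans (gM 0%R _); rewrite // in_itv/= lexx ler01.
have mkg : measurable_fun (`[0, 1] : set R) (EFin \o (fun s => k s * g s)).
  by apply/measurable_EFinP; exact: measurable_funM.
have mak : measurable_fun (`[0, 1] : set R) (fun s : R => `|k s|%:E).
  by apply/measurable_EFinP; exact: (measurableT_comp (@normr_measurable R _)).
have le : (\int[mu]_(s in `[0%R, 1%R]) `|(k s * g s)%:E| <= (K * M)%:E)%E.
  apply: (@le_trans _ _ (\int[mu]_(s in `[0%R, 1%R]) (M%:E * `|k s|%:E))%E).
    apply: ge0_le_integral => //=.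
    - by apply/measurable_EFinP; apply: (measurableT_comp (@normr_measurable R _));
      exact: measurable_funM.
    - exact: measurable_funeM.
    - move=> s s01; rewrite -EFinM lee_fin normrM mulrC ler_wpM2r//.
      by apply: gM.
  rewrite ge0_integralZl//.
  rewrite mulrC EFinM; apply: lee_wpmul2l => //.
have int : mu.-integrable (`[0, 1] : set R) (EFin \o (fun s => k s * g s)).
  by apply/integrableP; split => //; apply: le_lt_trans le _; rewrite ltry.
split => //.
rewrite -lee_fin EFin_normr_Rintegral//; apply: le_trans le.
exact: le_abse_integral.
Qed.

(** For [t] in [[0, 1]] this is [Gamma a] times the Riemann-Liouville integral of
    order [a] of [g] at [t]. *)
Definition rlint a g t : R :=
  \int[mu]_(s in `[0, 1]) (powker (a - 1) (t - s) * g s).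

(** Bounds the mass on [[0, 1]] of the kernels of [rlint], for [t] in [[0, 1]]. *)
Definition rlcst a : R := fine (powint (a - 1)).

Lemma rlcst_ge0 a : 0 <= rlcst a.
Proof. by rewrite fine_ge0// powint_ge0. Qed.

Lemma rlcstE a : 0 < a -> powint (a - 1) = (rlcst a)%:E.
Proof.
move=> a0; rewrite fineK// ge0_fin_numE ?powint_ge0//.
by apply: le_lt_trans (powint_le _) _; rewrite ?ltry//; lra.
Qed.

Let rlint_spec a g t M : 0 < a -> measurable_fun (`[0, 1] : set R) g ->
  {in `[0, 1], forall s, `|g s| <= M} -> 0 <= t <= 1 ->
  mu.-integrable (`[0, 1] : set R) (EFin \o (fun s => powker (a - 1) (t - s) * g s)) /\
  `|rlint a g t| <= rlcst a * M.
Proof.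
move=> a0 mg gM t01; apply: Rintegral_mul_bounded => //.
  exact: measurable_powker_sub.
rewrite (_ : \int[mu]_(s in _) _ =
    \int[mu]_(s in `[0%R, 1%R]) (powker (a - 1) (t - s))%:E)%E; last first.
  by apply: eq_integral => s _; rewrite ger0_norm ?powker_ge0.
rewrite integral_powker_cut//; last lra.
case/andP: t01 => t0 t1.
rewrite rlcstE// -EFinM lee_fin -[leRHS]mul1r ler_wpM2r ?rlcst_ge0//.
rewrite subrK; have := @ge0_ler_powR R a (ltW a0) t 1.
by rewrite powR1; apply; rewrite ?nnegrE.
Qed.

Lemma integrable_rlint a g t M : 0 < a -> measurable_fun (`[0, 1] : set R) g ->
  {in `[0, 1], forall s, `|g s| <= M} -> 0 <= t <= 1 ->
  mu.-integrable (`[0, 1] : set R) (EFin \o (fun s => powker (a - 1) (t - s) * g s)).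
Proof. by move=> a0 mg gM t01; have [] := rlint_spec a0 mg gM t01. Qed.

Lemma norm_rlint_le a g t M : 0 < a -> measurable_fun (`[0, 1] : set R) g ->
  {in `[0, 1], forall s, `|g s| <= M} -> 0 <= t <= 1 ->
  `|rlint a g t| <= rlcst a * M.
Proof. by move=> a0 mg gM t01; have [] := rlint_spec a0 mg gM t01. Qed.

Lemma rlint_ge0 a g t : {in `[0, 1], forall s, 0 <= g s} -> 0 <= rlint a g t.
Proof.
move=> g0; apply: Rintegral_ge0 => s s01.
by rewrite mulr_ge0 ?powker_ge0// g0.
Qed.

Lemma rlint0 a g : rlint a g 0 = 0.
Proof.
rewrite /rlint (@eq_Rintegral _ _ _ _ _ (cst 0)).
  by rewrite Rintegral_cst ?mul0r//; exact: measurable_itv.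
move=> s; rewrite inE/= in_itv/= => /andP[s0 _].
by rewrite powker_le0 ?mul0r// sub0r oppr_le0.
Qed.

Lemma rlint_holder a g t t' M : 0 < a < 1 -> measurable_fun (`[0, 1] : set R) g ->
  {in `[0, 1], forall s, `|g s| <= M} -> 0 <= t <= 1 -> 0 <= t' <= 1 ->
  `|rlint a g t' - rlint a g t| <= 2 * rlcst a * M * `|t' - t| `^ a.
Proof.
move=> /andP[a0 a1] mg gM.
wlog tt' : t t' / t <= t'.
  move=> wl t01 t'01; have [tt'|/ltW t't] := leP t t'; first exact: wl.
  by rewrite distrC [X in X `^ a]distrC; exact: wl.
move=> /[dup] /andP[t0 t1] t01 /[dup] /andP[t'0 t'1] t'01.
have it := integrable_rlint a0 mg gM t01.
have it' := integrable_rlint a0 mg gM t'01.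
rewrite /rlint -RintegralB//.
under eq_Rintegral do rewrite -mulrBl.
have mk : measurable_fun (`[0, 1] : set R)
    (fun s => powker (a - 1) (t' - s) - powker (a - 1) (t - s)).
  by apply: measurable_funB; exact: measurable_powker_sub.
have [|_] := @Rintegral_mul_bounded _ g (2 * `|t' - t| `^ a * rlcst a) M mk mg _ gM.
  have := @integral_powker_diff R (a - 1) t t' 1.
  rewrite subrK rlcstE// -EFinM ger0_norm ?subr_ge0//; apply => //; lra.
by move/le_trans; apply; rewrite le_eqVlt; apply/orP; left; apply/eqP; ring.
Qed.

Lemma rlint_dist a g h t M e : 0 < a -> measurable_fun (`[0, 1] : set R) g ->
  measurable_fun (`[0, 1] : set R) h -> {in `[0, 1], forall s, `|g s| <= M} ->
  {in `[0, 1], forall s, `|g s - h s| <= e} -> 0 <= t <= 1 ->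
  `|rlint a g t - rlint a h t| <= rlcst a * e.
Proof.
move=> a0 mg mh gM ghe t01.
have hM : {in `[0, 1], forall s, `|h s| <= M + e}.
  move=> s s01; rewrite -(subKr (g s) (h s)) (le_trans (ler_normB _ _))//.
  by rewrite lerD ?gM ?ghe.
rewrite /rlint -RintegralB//;
  try exact: (integrable_rlint a0 _ gM); try exact: (integrable_rlint a0 _ hM).
under eq_Rintegral do rewrite -mulrBr.
by apply: norm_rlint_le => //; exact: measurable_funB.
Qed.

End riemann_liouville.

(** * The Caputo derivative of a Riemann-Liouville integral *)

Section caputo_of_riemann_liouville.
Context {R : realType}.
Notation mu := (@lebesgue_measure R).
Implicit Types (a c M r s t : R) (g u : R -> R).

Definition betacst a : R := fine (betaint (- a) (a - 1)).

Lemma betacstE a : 0 < a < 1 -> betaint (- a) (a - 1) = (betacst a)%:E.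
Proof. by move=> a01; rewrite fineK// betaint_fin_num//; lra. Qed.

Lemma betacst_gt0 a : 0 < a < 1 -> 0 < betacst a.
Proof.
by move=> a01; rewrite -lte_fin -betacstE//; apply: betaint_gt0; lra.
Qed.

(** Exchanging the integrals, the inner one becomes the convolution of
    [powker (- a)] and [powker (a - 1)], whose exponents add up to [-1]: it is
    constant on [r < t]. *)
Lemma tonelli_powker a t (g : R -> R) : 0 < a < 1 -> measurable_fun setT g ->
  (forall r, 0 <= g r) ->
  (\int[mu]_s \int[mu]_r (powker (- a) (t - s) * powker (a - 1) (s - r) * g r)%:E =
   \int[mu]_r (if (r < t)%R then (betacst a * g r)%:E else 0))%E.
Proof.
move=> a01 mg g0.
pose f (z : R * R) := (powker (- a) (t - z.1) * powker (a - 1) (z.1 - z.2) * g z.2)%:E.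
have mf : measurable_fun setT f.
  apply/measurable_EFinP; apply: measurable_funM; first apply: measurable_funM.
  - apply: (measurableT_comp (measurable_powker (- a))).
    by apply: measurable_funB.
  - apply: (measurableT_comp (measurable_powker (a - 1))).
    by apply: measurable_funB.
  - exact: (measurableT_comp mg).
have f0 z : (0 <= f z)%E by rewrite lee_fin !mulr_ge0 ?powker_ge0.
rewrite (fubini_tonelli (m1 := mu) (m2 := mu) f mf f0).
apply: eq_integral => r _; rewrite /f /=.
under eq_integral do rewrite mulrC EFinM.
have mk : measurable_fun setT (fun s : R => (powker (- a) (t - s) * powker (a - 1) (s - r))%:E).
  apply/measurable_EFinP; apply: measurable_funM; first exact: measurable_powker_sub.
  apply: (measurableT_comp (measurable_powker (a - 1))).
  by apply: measurable_funB => //; exact: measurable_id.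
rewrite ge0_integralZl//; first last.
- by rewrite lee_fin.
- by move=> s _; rewrite lee_fin mulr_ge0// powker_ge0.
case: ifPn => [rt|].
  rewrite integral_powker_conv// betacstE//.
  have -> : - a + (a - 1) + 1 = 0 by ring.
  by rewrite powRr0 mul1e -EFinM mulrC.
rewrite -leNgt => tr; rewrite (@integral0_eq _ _ _ _ _ _ _) ?mule0// => s _.
have [ts|st] := leP t s; first by rewrite powker_le0 ?mul0r// subr_le0.
by rewrite (@powker_le0 _ (a - 1)) ?mulr0// subr_le0 (le_trans (ltW st)).
Qed.

(** Associativity of the convolution with the two power kernels: up to constants,
    integrating to order [1 - a] after order [a] is integrating once. *)
Lemma caputo_integral_rlint a c M g u t : 0 < a < 1 -> 0 <= c ->
  measurable_fun (`[0, 1] : set R) g -> {in `[0, 1], forall s, 0 <= g s <= M} ->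
  (forall s, 0 <= s <= 1 -> u s = c * rlint a g s) -> 0 <= t <= 1 ->
  caputo_integral a u t = betacst a * c * \int[mu]_(s in `[0, t]) g s.
Proof.
move=> a01 c0 mg gM uE /andP[t0 t1].
have a0 : 0 < a by case/andP: a01.
have gM' : {in `[0, 1], forall s, `|g s| <= M}.
  by move=> s /gM /andP[h1 h2]; rewrite ger0_norm.
pose h := (fun r => c * g r) \_ `[0, 1].
have h0 r : 0 <= h r.
  rewrite /h patchE mem_setE; case: ifP => // r01.
  by rewrite mulr_ge0//; have /andP[] := gM _ r01.
have mh : measurable_fun setT h.
  apply/(measurable_restrictT _ (measurable_itv _)).
  exact: measurable_funM.
have u0 : u 0 = 0 by rewrite uE ?lexx ?ler01// rlint0 mulr0.
have inner s : 0 <= s <= t -> (\int[mu]_r (powker (- a) (t - s) * powker (a - 1) (s - r) * h r)%:E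
    = ((t - s) `^ (- a) * (u s - u 0))%:E)%E.
  move=> /andP[s0 st]; have s01 : 0 <= s <= 1 by rewrite s0 (le_trans st).
  rewrite u0 subr0 uE//.
  transitivity (\int[mu]_(r in `[0%R, 1%R])
      ((powker (- a) (t - s) * c)%:E * (powker (a - 1) (s - r) * g r)%:E))%E.
    rewrite [RHS]integral_mkcond; apply: eq_integral => r _.
    rewrite /h !patchE mem_setE; case: ifP => _; last by rewrite mulr0.
    by rewrite -EFinM; congr EFin; ring.
  have intg := integrable_rlint a0 mg gM' s01.
  rewrite integralZl// /rlint /Rintegral.
  rewrite -[X in (_ * X)%E]fineK ?integrable_fin_num// -EFinM; congr EFin.
  rewrite -mulrA; congr (_ * _).
  rewrite /powker; case: ifPn => //; rewrite subr_gt0 -leNgt => ts.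
  have -> : t - s = 0 by apply/eqP; rewrite subr_eq0 eq_le ts st.
  by rewrite powR0// oppr_eq0 gt_eqF.
rewrite /caputo_integral /Rintegral.
transitivity (fine (\int[mu]_s \int[mu]_r
    (powker (- a) (t - s) * powker (a - 1) (s - r) * h r)%:E)%E).
  congr fine; rewrite integral_mkcond; apply: eq_integral => s _.
  rewrite patchE mem_setE in_itv/=; case: ifPn => [/inner ->//|sn].
  rewrite (@integral0_eq _ _ _ _ _ _ _)// => r _.
  have [ts|st] := leP t s; first by rewrite powker_le0 ?mul0r// subr_le0.
  have s0 : s < 0 by move: sn; rewrite (ltW st) andbT -ltNge.
  rewrite /h patchE mem_setE in_itv/=; case: ifPn => [/andP[r0 _]|]; last by rewrite mulr0.
  by rewrite (@powker_le0 _ (a - 1)) ?mulr0 ?mul0r// subr_le0; apply: ltW; exact: lt_le_trans r0.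
rewrite tonelli_powker//.
transitivity (fine (\int[mu]_(r in `[0%R, t[) ((betacst a * c)%:E * (g r)%:E))%E).
  congr fine; rewrite [RHS]integral_mkcond; apply: eq_integral => r _.
  rewrite /h !patchE !mem_setE !in_itv/=.
  have [rt|tr] := ltP r t; last by rewrite andbF.
  rewrite andbT (le_trans (ltW rt) t1) andbT.
  by case: ifP => _; rewrite ?mulr0// -EFinM; congr EFin; ring.
have mgt : measurable_fun (`[0, t] : set R) g.
  by apply: measurable_funS mg => //; apply: subset_itvl; rewrite bnd_simp.
have mgt' : measurable_fun (`[0, t[ : set R) g.
  by apply: measurable_funS mgt => //; apply: subset_itvl; rewrite bnd_simp.
rewrite integral_itv_bndo_bndc; last by apply/measurable_EFinP; apply: measurable_funM.
rewrite ge0_integralZl//; first last.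
- by rewrite lee_fin mulr_ge0// ltW// betacst_gt0.
- move=> r; rewrite /= in_itv/= => /andP[r0 rt].
  have r01 : r \in `[0, 1] by rewrite in_itv/= r0 (le_trans rt).
  by rewrite lee_fin; have /andP[] := gM r r01.
- exact/measurable_EFinP.
rewrite fineM// integrable_fin_num//=.
apply: (@measurable_bounded_integrable _ _ _ mu) => //.
  by rewrite [ltLHS]lebesgue_measure_itv/=; case: ifP => _; rewrite ?ltry// -EFinB ltry.
exists M; split; first exact: num_real.
move=> x Mx r; rewrite /= in_itv/= => /andP[r0 rt].
by rewrite (le_trans _ (ltW Mx))// gM'// in_itv/= r0 (le_trans rt).
Qed.

End caputo_of_riemann_liouville.

Section gamma_and_derivative.
Context {R : realType}.
Notation mu := (@lebesgue_measure R).

(** The integral is finite because the integrand is at most [x `^ (z - 1)] on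
    [[0, 1]] and at most [expR (- x)] beyond; it is positive because the integrand
    is at least [expR (- 1)] on [[0, 1]]. *)
Lemma Gamma_gt0 (z : R) : 0 < z <= 1 -> 0 < Gamma z.
Proof.
move=> /andP[z0 z1].
have mg (D : set R) : measurable_fun D (fun x : R => (x `^ (z - 1) * expR (- x))%:E).
  apply/measurable_EFinP; apply: measurable_funTS.
  apply: measurable_funM; first exact: measurable_powR.
  by apply: (measurableT_comp (@measurable_expR R)); exact: oppr_measurable.
have g0 (x : R) : (0 <= (x `^ (z - 1) * expR (- x))%:E)%E.
  by rewrite lee_fin mulr_ge0 ?powR_ge0 ?expR_ge0.
rewrite /Gamma /Rintegral fine_gt0//; apply/andP; split.
  apply: (@lt_le_trans _ _ (\int[mu]_(x in `]0%R, 1%R]) (cst (expR (- 1))%:E x))%E).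
    rewrite integral_cst//= lebesgue_measure_itv/= lte_fin ltr01 sube0 mule1.
    by rewrite lte_fin expR_gt0.
  apply: (@le_trans _ _ (\int[mu]_(x in `]0%R, 1%R]) (x `^ (z - 1) * expR (- x))%:E)%E).
    apply: ge0_le_integral => //.
    - by move=> x _; rewrite lee_fin expR_ge0.
    - exact: mg.
    - move=> x; rewrite /= in_itv/= => /andP[x0 x1]; rewrite lee_fin -[leLHS]mul1r.
      rewrite ler_pM// ?expR_ge0//; last by rewrite ler_expR lerN2.
      have zn : z - 1 <= 0 by lra.
      by have := powker_anti zn x0 x1; rewrite !powker_gt0// powR1.
  apply: ge0_subset_integral => //; first exact: mg.
  by apply: subset_itvl; rewrite bnd_simp.
pose p (x : R) := (powker (z - 1) x)%:E.
apply: (@le_lt_trans _ _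
  (\int[mu]_x ((p \_ `[0%R, 1%R]) x + (exponential_pdf 1 x)%:E))%E); last first.
  have mp : measurable_fun setT (p \_ `[0%R, 1%R]).
    apply/(measurable_restrictT _ (measurable_itv _)).
    exact: measurable_EFin_powker.
  rewrite ge0_integralD//; first last.
  - by apply/measurable_EFinP; exact: measurable_exponential_pdf.
  - by move=> x _; rewrite lee_fin exponential_pdf_ge0.
  - by move=> x _; apply: erestrict_ge0 => y _; rewrite lee_fin powker_ge0.
  rewrite integral_exponential_pdf// -integral_mkcond.
  rewrite lte_add_pinfty ?ltry//.
  by apply: le_lt_trans (powint_le _) _; rewrite ?ltry//; lra.
rewrite integral_mkcond; apply: ge0_le_integral => //.
- by move=> x _; apply: erestrict_ge0.
- by apply/(measurable_restrictT _ (measurable_itv _)).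
- apply: emeasurable_funD.
    apply/(measurable_restrictT _ (measurable_itv _)).
    exact: measurable_EFin_powker.
  by apply/measurable_EFinP; exact: measurable_exponential_pdf.
move=> x _; rewrite !patchE !mem_setE !in_itv/= andbT.
have [x0|x0] := ltP 0 x; last first.
  rewrite adde_ge0 ?lee_fin ?exponential_pdf_ge0//.
  by case: ifP => // _; rewrite lee_fin powker_ge0.
rewrite (ltW x0)/=; have [x1|x1] := leP x 1.
  rewrite -[leLHS]adde0 leeD ?lee_fin ?exponential_pdf_ge0//.
  rewrite powker_gt0// -[leRHS]mulr1 ler_wpM2l ?powR_ge0//.
  by rewrite -expR0 ler_expR oppr_le0 ltW.
rewrite add0e lee_fin exponential_pdfE ?(ltW x0)//.
rewrite mul1r mulN1r -[leRHS]mul1r ler_wpM2r ?expR_ge0//.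
have zn : z - 1 <= 0 by lra.
by have := powker_anti zn ltr01 (ltW x1); rewrite !powker_gt0// powR1.
Qed.

Lemma is_derive_within_FTC1 (D : set R) (g F : R -> R) (K t : R) : continuous g ->
  0 < t -> D t -> (forall s, D s -> F s = K * \int[mu]_(r in `[0, s]) g r) ->
  is_derive_within D F t (K * g t).
Proof.
move=> cg t0 Dt FE.
have ig : mu.-integrable (`[0, t + 1] : set R) (EFin \o g).
  apply: continuous_compact_integrable; first exact: segment_compact.
  exact: continuous_subspaceT.
have tt1 : t < t + 1 by rewrite ltrDl.
have [dG G'] := continuous_FTC1_closed tt1 ig t0 (cg t).
have {dG G'} : is_derive t 1 (fun s => K * \int[mu]_(r in `[0, s]) g r) (K * g t).
  have dG' : is_derive t 1 (fun s => \int[mu]_(r in `[0, s]) g r) (g t).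
    by apply: (DeriveDef dG); rewrite -derive1E.
  exact: (is_deriveZ K).
move=> [dF F'].
apply/cvgrPdist_le => e e0.
have := dF; rewrite /derivable => /cvg_ex[l /= hl].
have lE : l = K * g t by rewrite -F'; apply/esym/cvg_lim => //; exact: hl.
move/cvgrPdist_le : hl => /(_ e e0) [d /= d0 dP].
apply/nbhs_ballP; exists d => //= s ts st Ds.
have := dP (s - t).
rewrite /ball_/= sub0r opprB => /(_ ts); rewrite subr_eq0 => /(_ st).
rewrite lE [_%:A]mulr1 subrK -!FE// => h.
by rewrite [_ / _]mulrC; exact: h.
Qed.

End gamma_and_derivative.

(** * Moduli of continuity and compactness *)

Section modulus.
Context {R : realType}.

Lemma modulus_continuous (f : R -> R) :
  (forall e : R, 0 < e -> exists2 d : R, 0 < d &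
    forall x y, `|x - y| <= d -> `|f x - f y| <= e) -> continuous f.
Proof.
move=> fu x; apply/cvgrPdist_le => /= e e0.
have [d d0 dP] := fu e e0.
by apply/nbhs_ballP; exists d => //= y xy; apply: dP; exact: ltW.
Qed.

(** Heine-Cantor, by the covering form of compactness. *)
Lemma within_segment_unif_continuous (f : R -> R) (x y : R) :
  {within `[x, y], continuous f} -> forall e : R, 0 < e -> exists2 d : R, 0 < d &
  {in `[x, y] &, forall s t, `|s - t| <= d -> `|f s - f t| <= e}.
Proof.
move=> /subspace_continuousP cf e e0.
have /compact_near_coveringP := @segment_compact R x y.
move=> /(_ R 0^'+ (fun d s => s \in `[x, y] -> forall t, t \in `[x, y] ->
  `|s - t| <= d -> `|f s - f t| <= e) _)[].
  move=> z zxy.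
  have /cvgrPdist_le/(_ (e / 2)) := cf z zxy.
  rewrite divr_gt0// => /(_ isT)/nbhs_ballP[r /= r0 rP].
  have r2 : 0 < r / 2 by rewrite divr_gt0.
  exists (ball z (r / 2), [set d | d < r / 2]).
    split; first exact: nbhsx_ballx.
    exact: nbhs_right_lt.
  move=> [s d] /= [zs dr] sxy t txy std.
  have hs := rP s; have ht := rP t; rewrite /ball/= in zs hs ht.
  have := hs _ sxy; have := ht _ txy.
  move=> h1 h2; rewrite [leRHS]splitr.
  rewrite -(subrKA (f z)) (le_trans (ler_normD _ _))// lerD//.
    by rewrite distrC h2//; lra.
  apply: h1; rewrite -(subrKA s) (le_lt_trans (ler_normD _ _))// (splitr r) ltrD//.
  exact: le_lt_trans dr.
move=> d /= d0 dP; exists (d / 2); first by rewrite divr_gt0.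
have d2 : 0 < d / 2 by rewrite divr_gt0.
move=> s t sxy txy; apply: dP => //=.
by rewrite sub0r normrN gtr0_norm// ltr_pdivrMr// ltr_pMr// ltr1n.
Qed.

End modulus.

Section holder_compactness.
Context {R : realType}.
Implicit Types (a H B e t : R).

Lemma small_powR a H e : 0 < a -> 0 <= H -> 0 < e ->
  exists2 d, 0 < d & forall x, 0 <= x <= d -> H * x `^ a <= e.
Proof.
move=> a0 H0 e0; have H1 : 0 < H + 1 by lra.
have q0 : 0 <= e / (H + 1) by rewrite divr_ge0 // ltW.
exists ((e / (H + 1)) `^ a^-1); first by rewrite powR_gt0// divr_gt0.
move=> x /andP[x0 xd].
have : x `^ a <= e / (H + 1).
  have := @ge0_ler_powR R a (ltW a0) x ((e / (H + 1)) `^ a^-1).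
  rewrite -powRrM mulVf ?gt_eqF// powRr1//.
  by apply=> //; rewrite nnegrE ?powR_ge0.
rewrite ler_pdivlMr// => h; apply: le_trans h.
by rewrite mulrC ler_wpM2l ?powR_ge0//; lra.
Qed.

(** Arzela-Ascoli, in the form of a cluster point for uniform convergence on
    compact sets. *)
Lemma holder_cluster a H B (w : nat -> R -> R) : 0 < a -> 0 <= H ->
  (forall n t, `|w n t| <= B) ->
  (forall n t t', `|w n t' - w n t| <= H * `|t' - t| `^ a) ->
  exists u : R -> R, forall K : set R, compact K -> forall e, 0 < e ->
    forall N, exists2 n, (N <= n)%N & forall t, K t -> `|u t - w n t| < e.
Proof.
move=> a0 H0 wB wH.
pose W : set {family compact, R -> R} := range (w : nat -> {family compact, R -> R}).
have : precompact W.
  apply: pointwise_precompact_equicontinuous.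
  - exact: Rhausdorff.
  - move=> x.
    have : precompact (`[- B, B]%classic : set R).
      rewrite precompactE -(closure_id _).1; last exact: interval_closed.
      exact: segment_compact.
    apply: precompact_subset => _ [_ [n _ <-] <-] /=.
    by rewrite in_itv/= -ler_norml.
  - move=> x E; rewrite -entourage_ballE => -[e /= e0 eE].
    have [d d0 dP] := small_powR a0 H0 (divr_gt0 e0 (ltr0n _ 2)).
    apply/nbhs_ballP; exists d => //= y xy _ [n _ <-].
    apply: eE => /=; rewrite /ball/= distrC.
    apply: le_lt_trans (wH n x y) _.
    have := dP `|y - x|; rewrite normr_ge0/= => /(_ _)/le_lt_trans; apply.
      by move: xy; rewrite /ball/= distrC => /ltW.
    by rewrite ltr_pdivrMr// ltr_pMr// ltr1n.
rewrite precompactE => /(_ (w @ \oo)) [].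
  by exists 0%N => // n _; apply: subset_closure; exists n.
move=> u [_ clu]; exists u => K cK e e0 N.
have := clu [set w n | n in [set n | (N <= n)%N]]
  [set g | forall y, K y -> ball (u y) e (g y)].
case.
- by exists N => // n /= Nn; exists n.
- have entE : entourage [set xy : R * R | ball xy.1 e xy.2].
    by rewrite -entourage_ballE; exists e.
  exact: (fam_nbhs (u : {family compact, R -> R}) entE cK).
- by move=> g [[n Nn <-] h]; exists n => // t Kt; exact: h.
Qed.

End holder_compactness.

(** * Existence for the Volterra equation *)

Section clip.
Context {R : realType} (b : R).
Context (b0 : 0 <= b).
Implicit Types t s : R.

(** The nearest point of [[0, b]]. *)
Definition clip t : R := Num.max 0 (Num.min t b).

Lemma clip_itv t : 0 <= clip t <= b.
Proof. by move: b0; rewrite /clip /Order.max /Order.min; do ! case: ifPn; lra. Qed.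

Lemma clip_id t : 0 <= t <= b -> clip t = t.
Proof. by move: b0; rewrite /clip /Order.max /Order.min; do ! case: ifPn; lra. Qed.

Lemma clip_le0 t : t <= 0 -> clip t = 0.
Proof. by move: b0; rewrite /clip /Order.max /Order.min; do ! case: ifPn; lra. Qed.

Lemma clip_ge t : b <= t -> clip t = b.
Proof. by move: b0; rewrite /clip /Order.max /Order.min; do ! case: ifPn; lra. Qed.

Lemma clip_gt0 t : 0 < clip t -> clip t <= t.
Proof. by move: b0; rewrite /clip /Order.max /Order.min; do ! case: ifPn; lra. Qed.

Lemma clip_lip t s : `|clip t - clip s| <= `|t - s|.
Proof.
wlog ts : t s / s <= t.
  move=> wl; have [st|/ltW ts] := leP s t; first exact: wl.
  by rewrite distrC [leRHS]distrC; exact: wl.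
rewrite (ger0_norm (_ : 0 <= t - s)) ?subr_ge0//.
by move: b0; rewrite ger0_norm /clip /Order.max /Order.min; do ! case: ifPn; lra.
Qed.

End clip.

Section volterra.
Context {R : realType} (a c M : R) (phi : R -> R).
Context (a01 : 0 < a < 1) (c0 : 0 <= c)
  (phi_bnd : forall x, 0 <= phi x <= M)
  (phi_unif : forall e : R, 0 < e -> exists2 d : R, 0 < d &
    forall x y, `|x - y| <= d -> `|phi x - phi y| <= e).
Implicit Types (t s e d : R) (u v w : R -> R).

Let a0 : 0 < a. Proof. by case/andP: a01. Qed.
Let phi_cont : continuous phi. Proof. exact: modulus_continuous phi_unif. Qed.
Let M0 : 0 <= M. Proof. by have /andP[h /(le_trans h)] := phi_bnd 0. Qed.

(* Clipping the time makes [T v] a function on the whole line, so that delayed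
   arguments make sense. *)
Let T v t := c * rlint a (phi \o v) (clip 1 t).
Let B := c * (rlcst a * M).
Let H := c * (2 * rlcst a * M).
Let B0 : 0 <= B. Proof. by rewrite !mulr_ge0 ?rlcst_ge0. Qed.
Let H0 : 0 <= H. Proof. by rewrite !mulr_ge0 ?rlcst_ge0. Qed.

Let mphi v : measurable_fun setT v -> measurable_fun (`[0, 1] : set R) (phi \o v).
Proof.
move=> mv; apply: measurable_funTS; apply: measurableT_comp => //.
exact: continuous_measurable_fun.
Qed.

Let phiM v : {in `[0, 1], forall s, `|(phi \o v) s| <= M}.
Proof. by move=> s _ /=; have /andP[p0 pM] := phi_bnd (v s); rewrite ger0_norm. Qed.

Let T_bnd v t : measurable_fun setT v -> `|T v t| <= B.
Proof.
move=> mv; rewrite /T normrM (ger0_norm c0) ler_wpM2l//.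
by apply: norm_rlint_le => //; [exact: mphi|exact: (clip_itv ler01)].
Qed.

Let T_holder v t t' : measurable_fun setT v ->
  `|T v t' - T v t| <= H * `|t' - t| `^ a.
Proof.
move=> mv; rewrite /T -mulrBr normrM (ger0_norm c0) /H -[leRHS]mulrA ler_wpM2l//.
apply: le_trans (@rlint_holder _ _ _ (clip 1 t) (clip 1 t') M a01 (mphi mv) (@phiM v) _ _) _;
  try exact: (clip_itv ler01).
rewrite ler_wpM2l ?mulr_ge0 ?rlcst_ge0//.
by rewrite ge0_ler_powR ?nnegrE ?(ltW a0)//; exact: (clip_lip ler01).
Qed.

Let holder_continuous u : (forall t t', `|u t' - u t| <= H * `|t' - t| `^ a) ->
  continuous u.
Proof.
move=> uH t; apply/cvgrPdist_le => /= e e0.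
have [d d0 dP] := small_powR a0 H0 e0.
apply/nbhs_ballP; exists d => //= y ty; apply: le_trans (uH _ _) _.
by apply: dP; rewrite normr_ge0/= ltW.
Qed.

Let T_measurable v : measurable_fun setT v -> measurable_fun setT (T v).
Proof.
move=> mv; apply: continuous_measurable_fun; apply: holder_continuous => t t'.
exact: T_holder.
Qed.

Let mshift d v : measurable_fun setT v -> measurable_fun setT (fun s => v (s - d)).
Proof.
move=> mv; apply: (measurableT_comp mv).
by apply: measurable_funB => //; exact: measurable_id.
Qed.

(* The kernel vanishes for [s >= t]: [T] is causal. *)
Let eq_T v w t : (forall s, s < clip 1 t -> v s = w s) -> T v t = T w t.
Proof.
move=> vw; rewrite /T /rlint; congr (_ * _); apply: eq_Rintegral => s _ /=.
have [st|ts] := ltP s (clip 1 t); first by rewrite vw.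
by rewrite !powker_le0 ?mul0r// subr_le0.
Qed.

(* Picard iterates of the equation with delay [d]: its solution is determined step
   by step on [[0, d]], [[d, 2 d]], etc., so that the [n]-th iterate is already exact
   up to time [n d]. *)
Let delayed d : nat -> R -> R :=
  fix F n := if n is k.+1 then T (fun s => F k (s - d)) else cst 0.

Let delayed_measurable d n : measurable_fun setT (delayed d n).
Proof.
elim: n => [|n IH] /=; first exact: measurable_cst.
by apply: T_measurable; exact: mshift.
Qed.

Let T_le0 v t : t <= 0 -> T v t = 0.
Proof. by move=> t0; rewrite /T (clip_le0 ler01)// rlint0 mulr0. Qed.

Let delayed_stable d n t : 0 < d -> t <= n%:R * d ->
  delayed d n.+1 t = delayed d n t.
Proof.
move=> d0; elim: n t => [|n IH] t; first by rewrite mul0r => t0 /=; rewrite T_le0.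
move=> tn; rewrite /= -/(delayed d n.+1) -/(delayed d n).
apply: eq_T => s st.
have [s0|s0] := leP s 0.
  have sd0 : s - d <= 0 by lra.
  rewrite IH//; apply: le_trans sd0 _.
  by rewrite mulr_ge0// ltW.
rewrite -natr1 mulrDl mul1r in tn; apply: IH; rewrite lerBlDr.
apply: le_trans tn; apply: ltW; apply: (lt_le_trans st).
by apply: (clip_gt0 ler01); exact: lt_trans s0 st.
Qed.

(* The delayed solution solves the undelayed equation up to the oscillation of
   [phi \o w] over time [d], which the Hoelder bound makes small uniformly. *)
Let approx e : 0 < e -> exists w, [/\ measurable_fun setT w,
  (forall t, `|w t| <= B),
  (forall t t', `|w t' - w t| <= H * `|t' - t| `^ a) &
  (forall t, 0 <= t <= 1 -> `|w t - T w t| <= e)].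
Proof.
move=> e0.
have L0 : 0 < c * rlcst a + 1 by rewrite ltr_wpDl// mulr_ge0 ?rlcst_ge0.
have [d0 d0_gt0 phid] := phi_unif (divr_gt0 e0 L0).
have [d d_gt0 dP] := small_powR a0 H0 d0_gt0.
pose n := (Num.truncn d^-1).+1.
have nd : 1 <= n%:R * d.
  rewrite -ler_pdivrMr// div1r; apply: ltW.
  have dv : 0 <= d^-1 by rewrite invr_ge0 ltW.
  by have /andP[] := truncn_itv dv.
pose w := delayed d n.
exists w; split.
- exact: delayed_measurable.
- by move=> t; apply: T_bnd; apply: mshift; exact: delayed_measurable.
- by move=> t t'; apply: T_holder; apply: mshift; exact: delayed_measurable.
move=> t t01.
have -> : w t = T (fun s => w (s - d)) t.
  rewrite -[RHS]/(delayed d n.+1 t) delayed_stable//.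
  by case/andP: t01 => _ t1; apply: le_trans t1 nd.
rewrite /T -mulrBr normrM (ger0_norm c0).
have mw : measurable_fun setT w by exact: delayed_measurable.
have := @rlint_dist R a (phi \o (fun s => w (s - d))) (phi \o w) (clip 1 t) M
  (e / (c * rlcst a + 1)) a0 (mphi (mshift d mw)) (mphi mw) (@phiM _) _ (clip_itv ler01 t).
move=> /(_ _)/(ler_wpM2l c0) h; apply: le_trans (h _) _.
  move=> s _ /=; apply: phid; rewrite distrC.
  have := @T_holder (fun s => delayed d n.-1 (s - d)) (s - d) s (mshift d (delayed_measurable d _)).
  move=> /le_trans; apply; apply: dP; rewrite normr_ge0/=.
  by rewrite opprB addrC subrK gtr0_norm.
by rewrite mulrA mulrA ler_pdivrMr//; nra.
Qed.

(** Peano's theorem for the Abel kernel: the approximate solutions are uniformly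
    bounded and equi-Hoelder, and a cluster point [u] of them satisfies [u = T u]
    on [[0, 1]] since [T] is continuous for uniform convergence. *)
Lemma volterra_exists : exists2 u : R -> R, continuous u &
  forall t, 0 <= t <= 1 -> u t = c * rlint a (phi \o u) t.
Proof.
have /choice[w hw] : forall n : nat, exists w, [/\ measurable_fun setT w,
  (forall t, `|w t| <= B),
  (forall t t', `|w t' - w t| <= H * `|t' - t| `^ a) &
  (forall t, 0 <= t <= 1 -> `|w t - T w t| <= n.+1%:R^-1)].
  by move=> n; apply: approx; rewrite invr_gt0.
have wB n t : `|w n t| <= B by have [] := hw n.
have wH n t t' : `|w n t' - w n t| <= H * `|t' - t| `^ a by have [] := hw n.
have [u uP] := holder_cluster a0 H0 wB wH.
have cu : continuous u.
  apply: holder_continuous => t t'; apply/ler_addgt0Pr => e e0.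
  have e2 : 0 < e / 2 by lra.
  have cK : compact ([set t; t'] : set R).
    by apply: compactU; exact: compact_set1.
  have [n _ hn] := uP _ cK _ e2 0%N.
  have h1 := hn t (or_introl erefl); have h2 := hn t' (or_intror erefl).
  have := wH n t t'; move: h1 h2.
  set X := H * _; rewrite !ltr_norml !ler_norml => /andP[? ?] /andP[? ?] /andP[? ?].
  by apply/andP; split; lra.
have mu_ : measurable_fun setT u by exact: continuous_measurable_fun.
exists u => // t t01.
have -> : c * rlint a (phi \o u) t = T u t by rewrite /T (clip_id ler01).
apply/eqP; rewrite -subr_eq0 -normr_le0; apply/ler_addgt0Pr => e e0; rewrite add0r.
have e3 : 0 < e / 3 by lra.
have L0 : 0 < c * rlcst a + 1 by rewrite ltr_wpDl// mulr_ge0 ?rlcst_ge0.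
have [d d0 phid] := phi_unif (divr_gt0 e3 L0).
have m0 : 0 < Num.min (e / 3) d by rewrite lt_min e3 d0.
have cK : compact (`[0, 1]%classic : set R) by exact: segment_compact.
have [n Nn hn] := uP _ cK _ m0 (Num.truncn (e / 3)^-1).
have [mw _ _ /(_ _ t01) wT] := hw n.
have n3 : n.+1%:R^-1 <= e / 3.
  rewrite invf_ple ?posrE//.
  have ev : 0 <= (e / 3)^-1 by rewrite invr_ge0 ltW.
  have /andP[_ /ltW/le_trans] := truncn_itv ev; apply.
  by rewrite ler_nat.
have uw : `|u t - w n t| <= e / 3.
  apply: ltW; apply: lt_le_trans (hn t _) _; first by rewrite /= in_itv.
  by rewrite ge_min lexx.
have Tuw : `|T (w n) t - T u t| <= e / 3.
  rewrite /T -mulrBr normrM (ger0_norm c0).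
  have := @rlint_dist R a (phi \o w n) (phi \o u) (clip 1 t) M
    (e / 3 / (c * rlcst a + 1)) a0 (mphi mw) (mphi mu_) (@phiM _) _ (clip_itv ler01 t).
  move=> /(_ _)/(ler_wpM2l c0) h; apply: le_trans (h _) _.
    move=> s s01 /=; apply: phid; rewrite distrC ltW//.
    apply: lt_le_trans (hn s _) _; first by [].
    by rewrite ge_min lexx orbT.
  by rewrite mulrA mulrA ler_pdivrMr//; nra.
have := le_trans wT n3.
move: uw Tuw; rewrite !ler_norml => /andP[? ?] /andP[? ?] /andP[? ?].
by apply/andP; split; lra.
Qed.

End volterra.

(** * Solutions stay below a level at which the source vanishes *)

Section comparison.
Context {R : realType}.
Implicit Types (a c M t b e : R) (g u : R -> R).

(** Let [r] be the last time before [t] with [u r = x]. If [u t > x], then [u >= x]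
    on [[r, t]], so the source [g] vanishes there, and the contribution of [g] from
    before [r] only decreases from time [r] to time [t], as does the kernel:
    [u t <= u r = x]. *)
Lemma rlint_le_threshold a c M x g u : 0 < a < 1 -> 0 <= c ->
  measurable_fun (`[0, 1] : set R) g -> {in `[0, 1], forall s, 0 <= g s <= M} ->
  continuous u -> (forall t, 0 <= t <= 1 -> u t = c * rlint a g t) ->
  0 <= x -> (forall s, 0 <= s <= 1 -> x <= u s -> g s = 0) ->
  forall t, 0 <= t <= 1 -> u t <= x.
Proof.
move=> a01 c0 mg gM cu uE x0 gx t t01; rewrite leNgt; apply/negP => xt.
have [t0 t1] := andP t01.
have u0 : u 0 = 0 by rewrite uE ?lexx ?ler01// rlint0 mulr0.
have a0 : 0 < a by case/andP: a01.
have gM' : {in `[0, 1], forall s, `|g s| <= M}.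
  by move=> s /gM /andP[h1 h2]; rewrite ger0_norm.
have ivt s : 0 <= s <= t -> u s <= x -> exists2 r, s <= r <= t & u r = x.
  move=> /andP[s0 st] usx.
  have [|r] := @IVT R u s t x st (continuous_subspaceT cu).
    by rewrite ge_min le_max usx (ltW xt) orbT.
  by rewrite in_itv/=; exists r.
pose S : set R := `[0, t]%classic `&` u @^-1` [set x].
have cS : compact S.
  apply: compact_closedI; first exact: segment_compact.
  by apply: closed_comp => // ? _; exact: cu.
have S0 : S !=set0.
  have [||r rt ur] := ivt 0; [by rewrite lexx|by rewrite u0|].
  by exists r; split.
have [r rS rmax] := @compact_EVT_max R R id S S0 cS (continuous_subspaceT (fun _ => cvg_id)).
move: rS; rewrite inE => -[/= + ur]; rewrite in_itv/= => /andP[r0 rt].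
have r01 : 0 <= r <= 1 by rewrite r0 (le_trans rt).
have g0 s : r <= s -> s <= t -> g s = 0.
  move=> rs st; have s0 := le_trans r0 rs; have s1 := le_trans st t1.
  apply: gx; first by rewrite s0.
  move: rs; rewrite le_eqVlt => /predU1P[<-|rs]; first by rewrite ur.
  rewrite leNgt; apply/negP => /ltW usx.
  have [|r' /andP[sr' r't] ur'] := ivt s _ usx; first by rewrite s0.
  have /= := rmax r'; rewrite leNgt (lt_le_trans rs sr') => /(_ _)/negP; apply => //.
  by rewrite inE; split => //=; rewrite in_itv/= r't (le_trans s0).
move: xt; rewrite -ur ltNge => /negP; apply.
rewrite (uE t t01) (uE r r01); apply: (ler_wpM2l c0); apply: le_Rintegral.
- exact: measurable_itv.
- exact: integrable_rlint a0 mg gM' t01.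
- exact: integrable_rlint a0 mg gM' r01.
move=> s /= s01; have /andP[gs0 _] := gM _ s01.
have [sr|rs] := ltP s r.
  by rewrite ler_wpM2r// powker_anti ?subr_gt0 ?lerD2r//; lra.
have [st|ts] := leP s t; first by rewrite g0// !mulr0.
by rewrite powker_le0 ?mul0r ?mulr_ge0 ?powker_ge0// subr_le0 ltW.
Qed.

End comparison.

(** * The fractional differential equation *)

Theorem theorem3 (R : realType) (alpha E eta : R) (sigma : R -> R)
  (alpha01 : 0 < alpha < 1) (E_gt0 : 0 < E) (eta_gt0 : 0 < eta)
  (sigma_ge0 : forall x : R, 0 <= x -> 0 <= sigma x)
  (sigma_cont : {within `[0, +oo[, continuous sigma})
  (sigma_convex : convex_function (`[0, +oo[ : set R) sigma)
  (sigma_decr : forall x y : R, 0 <= x -> x <= y -> sigma y <= sigma x)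
  (E_0 : sigma x / x @[x --> 0^'+] --> +oo)
  (E_oo : sigma x / x @[x --> +oo] --> (0 : R)) :
  exists eps : R -> R,
    [/\ K01 eps,
        [bounded eps t | t in `[0, 1]],
        eps 0 = 0,
        (forall t : R, 0 < t <= 1 -> exists d,
           is_caputo alpha eps t d /\
           eta `^ alpha * d + E `^ alpha * eps t = sigma (eps t))
      & exists2 t : R, 0 <= t <= 1 & eps t != 0].
Proof.
have [a0 a1] := andP alpha01.
have sigma0_gt0 : 0 < sigma 0.
  near (0 : R)^'+ => x.
  have x0 : 0 < x by near: x; exact: nbhs_right_gt.
  have : 1 < sigma x / x.
    near: x; move/cvgryPgt : E_0 => /(_ 1); exact.
  rewrite ltr_pdivlMr// mul1r => xs; apply: lt_le_trans (sigma_decr 0 x _ (ltW x0)) => //.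
  exact: lt_trans x0 xs.
set k := E `^ alpha.
have k0 : 0 < k by rewrite powR_gt0.
pose f x := sigma x - k * x.
have f_decr x y : 0 <= x -> x <= y -> f y <= f x.
  by move=> x0 xy; rewrite lerB ?ler_pM2l//; exact: sigma_decr.
have cf b : {within `[0, b], continuous f}.
  have cs : {within `[0, b], continuous sigma}.
    by apply: continuous_subspaceW sigma_cont => x /=; rewrite !in_itv/= => /andP[->].
  have ck : {within `[0, b], continuous (fun z : R => k * z)}.
    by apply: continuous_subspaceT => z; exact: mulrl_continuous.
  by move=> x; apply: cvgB; [exact: cs|exact: ck].
have f0 : f 0 = sigma 0 by rewrite /f mulr0 subr0.
have [xs xs0 fxs] : exists2 xs, 0 <= xs & f xs = 0.
  have b0 : 0 <= sigma 0 / k by rewrite divr_ge0// ltW.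
  have fb : f (sigma 0 / k) <= 0.
    by rewrite /f [k * _]mulrC divfK ?gt_eqF// subr_le0 sigma_decr.
  have [|c] := @IVT R f 0 (sigma 0 / k) 0 b0 (cf _).
    by rewrite ge_min fb orbT le_max f0 ltW.
  by rewrite in_itv/= => /andP[c0 _] fc; exists c.
(* [phi] agrees with [f] on [[0, xs]], where the solution will be found to lie. *)
pose phi x := f (clip xs x).
have phi_bnd x : 0 <= phi x <= sigma 0.
  have /andP[c0 cx] := clip_itv xs0 x.
  by have := f_decr _ _ c0 cx; have := f_decr _ _ (lexx 0) c0; rewrite fxs f0 /phi => -> ->.
have phi_unif e : 0 < e -> exists2 d : R, 0 < d &
    forall x y, `|x - y| <= d -> `|phi x - phi y| <= e.
  move=> e0; have [d d0 dP] := within_segment_unif_continuous (cf xs) e0.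
  exists d => // x y xy; apply: dP; rewrite ?in_itv/= ?(clip_itv xs0)//.
  exact: le_trans (clip_lip xs0 x y) xy.
have phi_cont := modulus_continuous phi_unif.
have G0 : 0 < Gamma (1 - alpha) by apply: Gamma_gt0; lra.
have e0 : 0 < eta `^ alpha by rewrite powR_gt0.
have B0 := betacst_gt0 alpha01.
(* makes [(Gamma (1 - alpha))^-1 * (betacst alpha * c)] the inverse of
   [eta `^ alpha] *)
pose c := Gamma (1 - alpha) / (eta `^ alpha * betacst alpha).
have c_gt0 : 0 < c by rewrite divr_gt0// mulr_gt0.
have [u cu uE] := volterra_exists alpha01 (ltW c_gt0) phi_bnd phi_unif.
have mphi : measurable_fun (`[0, 1] : set R) (phi \o u).
  by apply: measurable_funTS; apply: continuous_measurable_fun => x;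
    apply: continuous_comp; [exact: cu|exact: phi_cont].
have bphi : {in `[0, 1], forall s, 0 <= (phi \o u) s <= sigma 0}.
  by move=> s _; exact: phi_bnd.
have u_ge0 t : 0 <= t <= 1 -> 0 <= u t.
  move=> /uE ->; rewrite mulr_ge0 ?(ltW c_gt0)//.
  by apply: rlint_ge0 => s /bphi /andP[].
have u_le t : 0 <= t <= 1 -> u t <= xs.
  apply: (rlint_le_threshold alpha01 (ltW c_gt0) mphi bphi cu uE xs0).
  by move=> s _ xu; rewrite /= /phi (clip_ge xs0).
have u0 : u 0 = 0 by rewrite uE ?lexx ?ler01// rlint0 mulr0.
have phiE t : 0 <= t <= 1 -> phi (u t) = sigma (u t) - k * u t.
  by move=> t01; rewrite /phi (clip_id xs0)// u_ge0//= u_le.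
have Du t : 0 <= t <= 1 -> caputo_integral alpha u t =
    betacst alpha * c * \int[lebesgue_measure]_(s in `[0, t]) (phi \o u) s.
  exact: (caputo_integral_rlint alpha01 (ltW c_gt0) mphi bphi uE).
have cphi : continuous (phi \o u).
  by move=> x; apply: continuous_comp; [exact: cu|exact: phi_cont].
exists u; split => //.
- split; last exact: u_ge0.
  exact: continuous_subspaceT.
- exists xs; split; first exact: num_real.
  move=> y xy t; rewrite /= in_itv/= => t01.
  by rewrite ger0_norm ?u_ge0// (le_trans (u_le _ t01))// ltW.
- move=> t /andP[t0 t1].
  have t01 : 0 <= t <= 1 by rewrite ltW.
  exists ((Gamma (1 - alpha))^-1 * (betacst alpha * c * (phi \o u) t)); split.
    eexists; last by [].
    apply: (is_derive_within_FTC1 cphi t0); first by rewrite /= in_itv.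
    by move=> s; rewrite /= in_itv/=; exact: Du.
  rewrite /= phiE// /c -/k.
  have -> : forall z, eta `^ alpha * ((Gamma (1 - alpha))^-1 *
      (betacst alpha * (Gamma (1 - alpha) / (eta `^ alpha * betacst alpha)) * z)) = z.
    by move=> z; field; rewrite !gt_eqF.
  by rewrite subrK.
(* The zero function would have zero Caputo integral, but the source would then be
   [sigma 0 > 0] throughout. *)
- apply: contrapT => u_eq0.
  have uz t : 0 <= t <= 1 -> u t = 0.
    move=> t01; apply/eqP/negPn/negP => ut; apply: u_eq0; by exists t.
  have i01 : 0 <= (1 : R) <= (1 : R) by rewrite lexx ler01.
  have intE : \int[lebesgue_measure]_(s in `[0, 1]) (phi \o u) s = sigma 0.
    rewrite (@eq_Rintegral _ _ _ _ _ (cst (sigma 0))); last first.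
      move=> s; rewrite inE/= in_itv/= => s01.
      by rewrite phiE// uz// mulr0 subr0.
    rewrite Rintegral_cst; last exact: measurable_itv.
    by rewrite [X in fine X]lebesgue_measure_itv/= lte_fin ltr01 sube0/= mulr1.
  have := Du 1 i01; rewrite intE.
  rewrite /caputo_integral (@eq_Rintegral _ _ _ _ _ (cst 0)); last first.
    move=> s; rewrite inE/= in_itv/= => s01.
    by rewrite u0 uz// subr0 mulr0.
  rewrite Rintegral_cst; last exact: measurable_itv.
  by rewrite mul0r => /esym/eqP; rewrite gt_eqF//; do 2 ?apply: mulr_gt0.
Unshelve. all: by end_near.
Qed.
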